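(* Let $M\in SL(2,\mathbb{Z})$ be one of the matrices $M_T$ in the table of the context, and suppose $M=G_1\cdots G_r$, where each $G_i$ is a conjugate of $U$ in $SL(2,\mathbb{Z})$. Then $r$ is greater than or equal to the number of factors in the minimal normal factorization (m.n.f.) of $M$. Moreover: (i) If $M$ is in one of the cases $wI_n$, $II$, $III$, $IV$, and $N$ is the number of factors in the m.n.f. of $M$, then after a finite number of Hurwitz moves the product $G_1\cdots G_r$ transforms into a product $C_1\cdots C_N D_{N+1}\cdots D_r$, where $C_1\cdots C_N$ is (factor by factor) the m.n.f. of $M$ and $D_{N+1}\cdots D_r=Id_{2\times 2}$. (ii) If $M$ is in one of the cases $I_n^*$, $II^*$, $III^*$, $IV^*$, and $N$ is the number of factors in the m.n.f. of $-M$, then after a finite number of Hurwitz moves the product $G_1\cdots G_r$ transforms into a product $C_1\cdots C_N D_{N+1}\cdots D_r$, where $C_1\cdots C_N$ is (factor by factor) the m.n.f. of $-M$ and $D_{N+1}\cdots D_r=-Id_{2\times 2}$.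
   Context: Let $U=\begin{bmatrix}1&1\\0&1\end{bmatrix}$ and $V=\begin{bmatrix}1&0\\-1&1\end{bmatrix}$ in $SL(2,\mathbb{Z})$; $V$ is a conjugate of $U$. Hurwitz moves: a product (ordered tuple of factors) $g_1'\cdots g_k'$ of elements of a group is obtained from $g_1\cdots g_k$ by a Hurwitz move if for some $1\le i\le k-1$ one has $g_j'=g_j$ for $j\notin\{i,i+1\}$ and either $g_i'=g_{i+1},\ g_{i+1}'=g_{i+1}^{-1}g_ig_{i+1}$, or $g_i'=g_ig_{i+1}g_i^{-1},\ g_{i+1}'=g_i$. Table (case $T$: matrix $M_T$; minimal normal factorization, a specific ordered product of factors each equal to $U$ or $V$; the empty product is the m.n.f. of $Id_{2\times2}$): $wI_n$ ($w\ge1$, $n\ge0$): $M_T=\begin{bmatrix}1&n\\0&1\end{bmatrix}$; m.n.f. $U^n$. $II$: $M_T=\begin{bmatrix}1&1\\-1&0\end{bmatrix}$; m.n.f. $VU$. $III$: $M_T=\begin{bmatrix}0&1\\-1&0\end{bmatrix}$; m.n.f. $VUV$. $IV$: $M_T=\begin{bmatrix}0&1\\-1&-1\end{bmatrix}$; m.n.f. $(VU)^2$. $I_n^*$ ($n\ge0$): $M_T=\begin{bmatrix}-1&-n\\0&-1\end{bmatrix}$; m.n.f. $U^n(VU)^3$ ($=-U^n$). $II^*$: $M_T=\begin{bmatrix}0&-1\\1&1\end{bmatrix}$; m.n.f. $(VU)^2(VU)^3$ ($=-(VU)^2$). $III^*$: $M_T=\begin{bmatrix}0&-1\\1&0\end{bmatrix}$;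 m.n.f. $VUV(VU)^3$ ($=-VUV$). $IV^*$: $M_T=\begin{bmatrix}-1&-1\\1&0\end{bmatrix}$; m.n.f. $VU(VU)^3$ ($=-VU$). Here $(VU)^k$ stands for the product of $2k$ factors $V,U,V,U,\ldots$, and $U^n$ for the product of $n$ factors $U$. If $M$ is in one of the starred cases then $-M$ is one of the matrices in the unstarred cases. *)

(* Defs.v *)
From HB Require Import structures.
From Stdlib Require Import Relation_Operators.
From mathcomp Require Import all_boot all_order all_algebra.

Set Implicit Arguments.
Unset Strict Implicit.
Unset Printing Implicit Defensive.

Import GRing.Theory.
Local Open Scope ring_scope.

Record SL2Z : Type := MkSL2Z {
  SL2Z_mx : 'M[int]_2;
  SL2Z_det : \det SL2Z_mx == 1
}.

HB.instance Definition _ := [isSub for SL2Z_mx].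
HB.instance Definition _ := [Choice of SL2Z by <:].

Fact SL2Z_one_subproof : \det (1%:M : 'M[int]_2) == 1.
Proof. by rewrite det1. Qed.

Fact SL2Z_mul_subproof (A B : SL2Z) : \det (SL2Z_mx A *m SL2Z_mx B) == 1.
Proof. by rewrite det_mulmx (eqP (SL2Z_det A)) (eqP (SL2Z_det B)) mulr1. Qed.

Fact SL2Z_inv_subproof (A : SL2Z) : \det (invmx (SL2Z_mx A)) == 1.
Proof. by rewrite det_inv (eqP (SL2Z_det A)) invr1. Qed.

Definition SL2Z_one : SL2Z := @MkSL2Z 1%:M SL2Z_one_subproof.
Definition SL2Z_mul (A B : SL2Z) : SL2Z :=
  @MkSL2Z (SL2Z_mx A *m SL2Z_mx B) (SL2Z_mul_subproof A B).
Definition SL2Z_inv (A : SL2Z) : SL2Z :=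
  @MkSL2Z (invmx (SL2Z_mx A)) (SL2Z_inv_subproof A).

Fact SL2Z_unitmx (A : SL2Z) : SL2Z_mx A \in unitmx.
Proof. by rewrite unitmxE (eqP (SL2Z_det A)) unitr1. Qed.

Fact SL2Z_mulA : associative SL2Z_mul.
Proof. by move=> A B C; apply: val_inj; exact: mulmxA. Qed.

Fact SL2Z_mul1 : left_id SL2Z_one SL2Z_mul.
Proof. by move=> A; apply: val_inj; exact: mul1mx. Qed.

Fact SL2Z_mulr1 : right_id SL2Z_one SL2Z_mul.
Proof. by move=> A; apply: val_inj; exact: mulmx1. Qed.

Fact SL2Z_mulV : left_inverse SL2Z_one SL2Z_inv SL2Z_mul.
Proof. by move=> A; apply: val_inj; apply: mulVmx (SL2Z_unitmx A). Qed.

Fact SL2Z_mulrV : right_inverse SL2Z_one SL2Z_inv SL2Z_mul.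
Proof. by move=> A; apply: val_inj; apply: mulmxV (SL2Z_unitmx A). Qed.

HB.instance Definition _ := isGroup.Build SL2Z
  SL2Z_mulA SL2Z_mul1 SL2Z_mulr1 SL2Z_mulV SL2Z_mulrV.

Definition mx2 (a b c d : int) : 'M[int]_2 :=
  \matrix_(i, j) nth 0 (nth [::] [:: [:: a; b]; [:: c; d]] i) j.

Lemma det_mx2 (a b c d : int) : \det (mx2 a b c d) = a * d - b * c.
Proof.
rewrite (expand_det_row _ ord0) !big_ord_recl big_ord0 addr0 /cofactor.
by rewrite !det_mx11 !mxE /= expr0 expr1 mul1r mulN1r mulrN.
Qed.

Fact SL2Z_U_subproof : \det (mx2 1 1 0 1) == 1.
Proof. by rewrite det_mx2. Qed.

Fact SL2Z_V_subproof : \det (mx2 1 0 (-1) 1) == 1.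
Proof. by rewrite det_mx2. Qed.

Definition U : SL2Z := @MkSL2Z (mx2 1 1 0 1) SL2Z_U_subproof.
Definition V : SL2Z := @MkSL2Z (mx2 1 0 (-1) 1) SL2Z_V_subproof.

Section Group.
Variable gT : groupType.
Local Open Scope group_scope.

Definition is_conjugate (x y : gT) : Prop := exists z : gT, y = x ^ z.

Definition product (s : seq gT) : gT := \prod_(g <- s) g.

Inductive hurwitz_move : seq gT -> seq gT -> Prop :=
| hurwitz_move_left (s t : seq gT) (g h : gT) :
    hurwitz_move (s ++ [:: g, h & t]) (s ++ [:: h, h^-1 * g * h & t])
| hurwitz_move_right (s t : seq gT) (g h : gT) :
    hurwitz_move (s ++ [:: g, h & t]) (s ++ [:: g * h * g^-1, g & t]).

Definition hurwitz_moves : seq gT -> seq gT -> Prop :=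
  clos_refl_trans (seq gT) hurwitz_move.

End Group.

(* [wI w n] stands for wI_n, whose multiplicity w >= 1 affects neither the    *)
(* matrix nor the factorization; [X_star] stands for X^*.                     *)
Inductive fiber_case : Type :=
| wI (w n : nat) of (0 < w)%N
| II
| III
| IV
| I_star (n : nat)
| II_star
| III_star
| IV_star.

Definition starred (T : fiber_case) : bool :=
  match T with
  | wI _ _ _ | II | III | IV => false
  | I_star _ | II_star | III_star | IV_star => true
  end.

Definition fiber_mx (T : fiber_case) : 'M[int]_2 :=
  match T with
  | wI _ n _ => mx2 1 n%:Z 0 1
  | II => mx2 1 1 (-1) 0
  | III => mx2 0 1 (-1) 0
  | IV => mx2 0 1 (-1) (-1)
  | I_star n => mx2 (-1) (- n%:Z) 0 (-1)
  | II_star => mx2 0 (-1) 1 1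
  | III_star => mx2 0 (-1) 1 0
  | IV_star => mx2 (-1) (-1) 1 0
  end.

Definition VU_pow (k : nat) : seq SL2Z := flatten (nseq k [:: V; U]).

Definition mnf (T : fiber_case) : seq SL2Z :=
  match T with
  | wI _ n _ => nseq n U
  | II => [:: V; U]
  | III => [:: V; U; V]
  | IV => VU_pow 2
  | I_star n => nseq n U ++ VU_pow 3
  | II_star => VU_pow 2 ++ VU_pow 3
  | III_star => [:: V; U; V] ++ VU_pow 3
  | IV_star => [:: V; U] ++ VU_pow 3
  end.

(* Main.v *)
Require Import Defs.
From HB Require Import structures.
From Stdlib Require Import Relation_Operators.
From mathcomp Require Import all_boot all_order all_algebra.
From mathcomp Require Import zify ring.

(* SL(2,Z) is generated by delta = VU, of order 6, and Delta = VUV, with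
   Delta^2 = delta^3 = -1 central. The cosets P <delta> are the vertices of a
   trivalent tree with root <delta>, and a conjugate of U acts on it as a
   translation by one edge along an axis (the boundary of a Farey horoball).
   Follow the root along the suffix products of G_1 ... G_r. If this path goes
   up by g_(i+1) and then down by g_i, Hurwitz moves on this pair lower the
   intermediate vertex, unless the path is leaving the root and returning to it,
   in which case the pair becomes (V, U). Hence G is equivalent to
   A_1 ... A_m (VU)^k, where the path moves away from the root along the A_i.
   Every matrix of the table is U^n delta^j with j < 6. For a product of that
   form, the geodesic from the root to its end always turns to the same side,
   which forces every A_i to be U; then m = n and k = j mod 6. *)

Set Implicit Arguments.
Unset Strict Implicit.
Unset Printing Implicit Defensive.

Import GRing.Theory.
Local Open Scope nat_scope.

(** * Words as the vertices of a rooted tree, with its metric *)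

Fixpoint lcp (u v : seq nat) : nat :=
  if u is a :: u' then
    if v is b :: v' then if a == b then (lcp u' v').+1 else 0 else 0
  else 0.

(* Distance in the tree on words where the parent of [rcons w i] is [w]. *)
Definition wdist (u v : seq nat) : nat := size u + size v - (lcp u v).*2.

Lemma lcp_sym u v : lcp u v = lcp v u.
Proof. by elim: u v => [|a u IH] [|b v] //=; rewrite eq_sym IH. Qed.

Lemma lcp_size u v : lcp u v <= size u.
Proof.
by elim: u v => [|a u IH] [|b v] //=; case: (_ == _) => //; rewrite ltnS IH.
Qed.

Lemma lcp_ultra u v w : minn (lcp u w) (lcp w v) <= lcp u v.
Proof.
elim: u v w => [|a u IH] [|b v] [|c w] //=; rewrite ?geq_minl ?geq_minr //.
have [->|ac] := eqVneq a c; have [cb|cb] := eqVneq c b; subst; rewrite ?eqxx //.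
by have := IH v w; lia.
Qed.

Lemma wdist_lcp u v : wdist u v + (lcp u v).*2 = size u + size v.
Proof.
by rewrite /wdist; have := lcp_size u v; have := lcp_size v u;
  rewrite lcp_sym; lia.
Qed.

(** [lcp] is the Gromov product based at the root, so [lcp_ultra] is 0-hyperbolicity seen from the
    root; four instances of it give the symmetric form for arbitrary points. *)
Lemma wdist_four_point p x y z :
  wdist p x + wdist y z <=
    maxn (wdist p y + wdist x z) (wdist p z + wdist x y).
Proof.
have := lcp_ultra p x y; have := lcp_ultra p x z.
have := lcp_ultra y z p; have := lcp_ultra y z x.
rewrite (lcp_sym y p) (lcp_sym y x) (lcp_sym z x).
have := wdist_lcp p x; have := wdist_lcp p y; have := wdist_lcp p z.
have := wdist_lcp y z; have := wdist_lcp x y; have := wdist_lcp x z.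
lia.
Qed.

Lemma wdistxx u : wdist u u = 0.
Proof. by elim: u => // a u; rewrite /wdist /= eqxx; lia. Qed.

Lemma wdist_eq0 u v : wdist u v = 0 -> u = v.
Proof.
move=> d0; have := wdist_lcp u v; rewrite d0.
elim: u v {d0} => [|a u IH] [|b v] //=.
have [->|_] := eqVneq a b; last by lia.
by move=> h; rewrite (IH v) //; lia.
Qed.

(** Only the first letter may be 0: the root has three children and every other vertex has two,
    which makes the tree trivalent. *)
Definition reduced (w : seq nat) : bool :=
  all (fun i => i < 3) w && all (fun i => 0 < i) (behead w).

(* [tact] and [sact] are the actions of delta and Delta on the vertex coded by a
   word, see [word_mx]: a letter is an exponent of delta, counted modulo 3
   because delta^3 is central. *)
Definition tact (w : seq nat) : seq nat :=
  if w is i :: w' then (i.+1 %% 3) :: w' else [::].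

Definition sact (w : seq nat) : seq nat :=
  if w is 0 :: w' then w' else 0 :: w.

Lemma tact_reduced w : reduced w -> reduced (tact w).
Proof.
by case: w => //= i w /andP[/= /andP[_ w3] w0]; rewrite /reduced /= ltn_pmod // w3.
Qed.

Lemma sact_reduced w : reduced w -> reduced (sact w).
Proof.
case: w => [|[|i] w] //=; rewrite /reduced /= => /andP[-> w0].
by case: w w0 => //= j w /andP[].
Qed.

Lemma wdist_tact u v :
  reduced u -> reduced v -> wdist (tact u) (tact v) = wdist u v.
Proof.
case: u v => [|i u] [|j v] //; rewrite /reduced /= => /andP[/andP[i3 _] _].
move=> /andP[/andP[j3 _] _]; rewrite /wdist /=.
suff -> : (i.+1 %% 3 == j.+1 %% 3) = (i == j) by [].
by case: i i3 => [|[|[]]] // _; case: j j3 => [|[|[]]].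
Qed.

(** Delta flips the edge between the root and [[:: 0]]. Words on the side of [[:: 0]] lose a letter
    and the others gain one. On the same side lengths and common prefix shift together; on opposite
    sides the shifts cancel and, by reducedness, no common prefix appears. *)
Lemma wdist_sact u v :
  reduced u -> reduced v -> wdist (sact u) (sact v) = wdist u v.
Proof.
move=> /andP[_ u0] /andP[_ v0]; rewrite /wdist; move: u0 v0.
case: u => [|[|i] u]; case: v => [|[|j] v] //= u0 v0; try lia.
- by case: v v0 => [|[|k] v] //= _; lia.
- by case: u u0 => [|[|k] u] //= _; lia.
- by case: u u0 => [|[|k] u] //= _; lia.
- by case: v v0 => [|[|k] v] //= _; lia.
Qed.

(** * Integer matrices of size 2, and relations between delta and Delta *)

Section Matrices.
Local Open Scope ring_scope.

Lemma mx2M (a b c d a' b' c' d' : int) :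
  mx2 a b c d *m mx2 a' b' c' d' =
    mx2 (a * a' + b * c') (a * b' + b * d') (c * a' + d * c') (c * b' + d * d').
Proof.
apply/matrixP => i j; rewrite !mxE !big_ord_recl big_ord0 !mxE /= addr0.
by case: i j => [[|[|[]]] //= ?] [[|[|[]]] //= ?].
Qed.

Lemma mx2_inj (a b c d a' b' c' d' : int) :
  mx2 a b c d = mx2 a' b' c' d' -> [/\ a = a', b = b', c = c' & d = d'].
Proof.
move=> /matrixP e.
by have := (e 0 0, e 0 1, e 1 0, e 1 1); rewrite !mxE /= => -[[[]]].
Qed.

Lemma mx2_eta (A : 'M[int]_2) : A = mx2 (A 0 0) (A 0 1) (A 1 0) (A 1 1).
Proof.
apply/matrixP => i j; rewrite !mxE.
by case: i j => [[|[|[]]] //= ?] [[|[|[]]] //= ?];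
  congr (A _ _); apply: val_inj.
Qed.

Lemma SL2Z_entries (P : SL2Z) :
  exists a b c d, SL2Z_mx P = mx2 a b c d /\ a * d - b * c = 1.
Proof.
have e := mx2_eta (SL2Z_mx P); do 4!eexists; split; first exact: e.
by rewrite -det_mx2 -e (eqP (SL2Z_det P)).
Qed.

Lemma mx2_1 : 1%:M = mx2 1 0 0 1.
Proof. by rewrite [LHS]mx2_eta !mxE. Qed.

Lemma mx2_N (a b c d : int) : - mx2 a b c d = mx2 (- a) (- b) (- c) (- d).
Proof. by rewrite [LHS]mx2_eta !mxE. Qed.

End Matrices.

Local Open Scope group_scope.

HB.lock Definition delta : SL2Z := V * U.
HB.lock Definition Delta : SL2Z := V * U * V.

Lemma SL2Z_mxM (P Q : SL2Z) : SL2Z_mx (P * Q) = (SL2Z_mx P *m SL2Z_mx Q)%R.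
Proof. by []. Qed.

Lemma SL2Z_mx_inj : injective SL2Z_mx.
Proof. exact: val_inj. Qed.

Lemma mx_1 : SL2Z_mx 1 = mx2 1 0 0 1.
Proof. exact: mx2_1. Qed.

Lemma mx_U : SL2Z_mx U = mx2 1 1 0 1.
Proof. by []. Qed.

Lemma mx_V : SL2Z_mx V = mx2 1 0 (-1) 1.
Proof. by []. Qed.

Lemma mx_delta : SL2Z_mx delta = mx2 1 1 (-1) 0.
Proof. by rewrite delta.unlock SL2Z_mxM mx_U mx_V mx2M. Qed.

Lemma mx_Delta : SL2Z_mx Delta = mx2 0 1 (-1) 0.
Proof. by rewrite Delta.unlock -delta.unlock SL2Z_mxM mx_delta mx_V mx2M. Qed.

Lemma mx_delta2 : SL2Z_mx (delta ^+ 2) = mx2 0 1 (-1) (-1).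
Proof. by rewrite SL2Z_mxM mx_delta mx2M. Qed.

Lemma mx_delta3 : SL2Z_mx (delta ^+ 3) = mx2 (-1) 0 0 (-1).
Proof. by rewrite expgS SL2Z_mxM mx_delta2 mx_delta mx2M. Qed.

Lemma mx_delta4 : SL2Z_mx (delta ^+ 4) = mx2 (-1) (-1) 1 0.
Proof. by rewrite expgS SL2Z_mxM mx_delta3 mx_delta mx2M. Qed.

Lemma mx_delta5 : SL2Z_mx (delta ^+ 5) = mx2 0 (-1) 1 1.
Proof. by rewrite expgS SL2Z_mxM mx_delta4 mx_delta mx2M. Qed.

Lemma delta6 : delta ^+ 6 = 1.
Proof.
by apply: SL2Z_mx_inj; rewrite expgS SL2Z_mxM mx_delta5 mx_delta mx2M mx_1.
Qed.

Lemma DeltaE : Delta = U * delta.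
Proof. by apply: SL2Z_mx_inj; rewrite mx_Delta SL2Z_mxM mx_U mx_delta mx2M. Qed.

Lemma Delta_sq : Delta * Delta = delta ^+ 3.
Proof. by apply: SL2Z_mx_inj; rewrite mx_delta3 SL2Z_mxM mx_Delta mx2M. Qed.

Lemma delta_V : delta * V = U * delta.
Proof. by rewrite -DeltaE delta.unlock Delta.unlock. Qed.

Lemma delta3_central (P : SL2Z) : commute P (delta ^+ 3).
Proof.
apply: SL2Z_mx_inj; rewrite (SL2Z_mxM P) (SL2Z_mxM _ P) mx_delta3.
by case: (SL2Z_entries P) => a [b [c [d [-> _]]]]; rewrite !mx2M;
  congr mx2; ring.
Qed.

Lemma delta_modn (j : nat) : delta ^+ j = delta ^+ (j %% 6).
Proof.
by rewrite {1}(divn_eq j 6) expgnDr mulnC expgnA delta6 expg1n mul1g.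
Qed.

Lemma deltaV : delta^-1 = delta ^+ 5.
Proof. by apply: mulg1_eq; rewrite -expgS delta6. Qed.

Section Alternating.
Local Open Scope ring_scope.

(* These matrices form a monoid that contains delta^k Delta for k prime to 3;
   it plays the part of a ping-pong set in the uniqueness of words. *)
Definition alternating (P : SL2Z) : Prop :=
  exists e a b c d : int,
    [/\ e = 1 \/ e = -1, 0 <= a, 0 <= b, 0 <= c & 0 <= d] /\
    SL2Z_mx P = mx2 (e * a) (- (e * b)) (- (e * c)) (e * d).

Lemma alternating1 : alternating 1%g.
Proof. by exists 1, 1, 0, 0, 1; split; [split; [left| | | |]|exact: mx2_1]. Qed.

Lemma alternatingM (P Q : SL2Z) :
  alternating P -> alternating Q -> alternating (P * Q)%g.
Proof.
move=> [e [a [b [c [d [[e1 a0 b0 c0 d0] hP]]]]]].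
move=> [e' [a' [b' [c' [d' [[e1' a0' b0' c0' d0'] hQ]]]]]].
exists (e * e'), (a * a' + b * c'), (a * b' + b * d'), (c * a' + d * c'),
  (c * b' + d * d'); split; last first.
  by rewrite SL2Z_mxM hP hQ mx2M; congr mx2; ring.
split; first by case: e1 e1' => -> [] ->; [left|right|right|left].
- by rewrite Num.Theory.addr_ge0 ?Num.Theory.mulr_ge0.
- by rewrite Num.Theory.addr_ge0 ?Num.Theory.mulr_ge0.
- by rewrite Num.Theory.addr_ge0 ?Num.Theory.mulr_ge0.
- by rewrite Num.Theory.addr_ge0 ?Num.Theory.mulr_ge0.
Qed.

Lemma alternating_delta_Delta (k : nat) :
  (k %% 3 != 0)%N -> alternating (delta ^+ k * Delta)%g.
Proof.
move=> k3; rewrite delta_modn.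
have : (k %% 6 < 6)%N by rewrite ltn_pmod.
have : ((k %% 6) %% 3 != 0)%N by rewrite modn_dvdm.
case: (k %% 6)%N => [|[|[|[|[|[|//]]]]]] // _ _.
- exists (-1), 1, 1, 0, 1; split; first by split => //; right.
  by rewrite SL2Z_mxM mx_delta mx_Delta mx2M.
- exists (-1), 1, 0, 1, 1; split; first by split => //; right.
  by rewrite SL2Z_mxM mx_delta2 mx_Delta mx2M.
- exists 1, 1, 1, 0, 1; split; first by split => //; left.
  by rewrite SL2Z_mxM mx_delta4 mx_Delta mx2M.
- exists 1, 1, 0, 1, 1; split; first by split => //; left.
  by rewrite SL2Z_mxM mx_delta5 mx_Delta mx2M.
Qed.

(** Comparing signs for each residue of [j] modulo 6 forces a row of [A] to vanish, against
    determinant 1. *)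
Lemma not_alternating (A : SL2Z) (j : nat) :
  alternating A -> ~ alternating (Delta * A * delta ^+ j)%g.
Proof.
move=> [e [a [b [c [d [[e1 a0 b0 c0 d0] hA]]]]]].
move=> [e' [a' [b' [c' [d' [[e1' a0' b0' c0' d0'] hQ]]]]]].
have detA : a * d - b * c = 1.
  have := SL2Z_det A; rewrite hA det_mx2 => /eqP <-.
  by case: e1 => ->; ring.
move: hQ; rewrite delta_modn; have : (j %% 6 < 6)%N by rewrite ltn_pmod.
case: (j %% 6)%N => [|[|[|[|[|[|//]]]]]] _;
  rewrite (SL2Z_mxM (Delta * A)%g) (SL2Z_mxM Delta) mx_Delta hA
    ?mx_1 ?mx_delta ?mx_delta2 ?mx_delta3 ?mx_delta4 ?mx_delta5 !mx2M
    => /mx2_inj[]; case: e1 e1' => -> [] -> *.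
all: have : (a = 0 /\ b = 0) \/ (c = 0 /\ d = 0) by lia.
all: by move=> [] [? ?]; subst; lia.
Qed.

End Alternating.

(** * Generation of SL(2,Z) by delta and Delta *)

Lemma mx_UX (n : nat) : SL2Z_mx (U ^+ n) = mx2 1 n%:Z 0 1.
Proof.
elim: n => [|n IH]; first exact: mx_1.
by rewrite expgS SL2Z_mxM mx_U IH mx2M; congr mx2; lia.
Qed.

Lemma U_inv : U^-1 = delta * (Delta * delta ^+ 3).
Proof.
apply: mulg1_eq; rewrite mulgA -DeltaE mulgA Delta_sq -expgnDr.
exact: delta6.
Qed.

Lemma mx_UVX (n : nat) : SL2Z_mx (U^-1 ^+ n) = mx2 1 (- n%:Z)%R 0 1.
Proof.
elim: n => [|n IH]; first exact: mx_1.
rewrite expgS SL2Z_mxM IH U_inv SL2Z_mxM (SL2Z_mxM Delta) mx_delta3 mx_Delta.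
by rewrite mx_delta !mx2M; congr mx2; lia.
Qed.

(** Euclid's algorithm on the first column: powers of U subtract multiples of the lower entry from
    the upper one, and Delta swaps the two up to sign. *)
Lemma SL2Z_generated (K : SL2Z -> Prop) :
  K 1 -> (forall P, K P -> K (delta * P)) -> (forall P, K P -> K (Delta * P)) ->
  forall P, K P.
Proof.
move=> K1 Kd KD.
have KdX n P : K P -> K (delta ^+ n * P).
  by move=> KP; elim: n => [|n IH]; rewrite ?mul1g // expgS -mulgA; apply: Kd.
have KU P : K P -> K (U * P).
  move=> KP; have -> : U = Delta * delta ^+ 5.
    by rewrite DeltaE -mulgA -expgS delta6 mulg1.
  by rewrite -mulgA; apply/KD/KdX.
have KUV P : K P -> K (U^-1 * P).
  by move=> KP; rewrite U_inv -mulgA -(mulgA Delta); apply/Kd/KD/KdX.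
have KZ (q : int) : exists2 Z, SL2Z_mx Z = mx2 1 q 0 1 &
    forall Q, K Q -> K (Z * Q).
  case: q => n.
    exists (U ^+ n); first exact: mx_UX.
    move=> Q KQ; elim: n => [|n IH]; first by rewrite mul1g.
    by rewrite expgS -mulgA; apply: KU.
  exists (U^-1 ^+ n.+1); first by rewrite mx_UVX.
  move=> Q KQ; elim: n.+1 => [|m IH]; first by rewrite mul1g.
  by rewrite expgS -mulgA; apply: KUV.
move=> P; case: (SL2Z_entries P) => a [b [c [d [hP det1]]]].
have [n] := ubnP `|c|%N; elim: n => // n IH in P a b c d hP det1 *.
rewrite ltnS => cn; have [c0|c0] := eqVneq c 0%R.
  have [Z hZ KZP] := KZ (a * b)%R.
  have a1 : (a = 1 \/ a = -1)%R.
    have ad1 : (a * d = 1)%R by rewrite -det1 c0; ring.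
    have /eqP : (`|a| * `|d| = 1)%N by rewrite -abszM ad1.
    by rewrite muln_eq1 => /andP[/eqP a1 _]; lia.
  have : P = Z \/ P = delta ^+ 3 * Z.
    case: a1 => a1; [left|right]; apply: SL2Z_mx_inj.
      rewrite hP hZ; congr mx2; subst; lia.
    rewrite hP SL2Z_mxM hZ mx_delta3 mx2M; congr mx2; subst; lia.
  have KZ1 : K Z by rewrite -(mulg1 Z); apply: KZP.
  by case=> ->; rewrite ?mul1g //; apply: KdX.
have [Z hZ KZP] := KZ (a %/ c)%Z.
have [Z' hZ' _] := KZ (- (a %/ c)%Z)%R.
set R := Delta * (Z' * P).
have hR : SL2Z_mx R =
    mx2 c d (- (a %% c)%Z) (- (b - (a %/ c)%Z * d)).
  rewrite /R SL2Z_mxM (SL2Z_mxM Z') hZ' hP mx_Delta !mx2M.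
  by have e := divz_eq a c; congr mx2; lia.
(* Delta has order 4, so its cube undoes the Delta in [R], whose lower left entry is a remainder
   modulo [c]. *)
have -> : P = Z * (Delta * (Delta * (Delta * R))).
  apply: SL2Z_mx_inj.
  rewrite SL2Z_mxM hZ 3!(SL2Z_mxM Delta) hR mx_Delta hP !mx2M.
  by have e := divz_eq a c; congr mx2; lia.
apply/KZP/KD/KD/KD/(IH R _ _ _ _ hR); last first.
  have := ltz_mod a c0; have := modz_ge0 a c0; lia.
by rewrite -det_mx2 -hR; apply/eqP/SL2Z_det.
Qed.

(** * Normal forms for the cosets of the powers of delta *)

Definition same_vertex (P Q : SL2Z) : Prop := exists j, P = Q * delta ^+ j.

Lemma same_vertex_refl P : same_vertex P P.
Proof. by exists 0; rewrite mulg1. Qed.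

Lemma same_vertex_sym P Q : same_vertex P Q -> same_vertex Q P.
Proof.
(* As delta has order 6, the exponent [5 * j] serves here and below as [- j]. *)
move=> [j ->]; exists (5 * j)%N; rewrite -mulgA -expgnDr -mulSn expgnA delta6.
by rewrite expg1n mulg1.
Qed.

Lemma same_vertex_trans P Q R :
  same_vertex P Q -> same_vertex Q R -> same_vertex P R.
Proof. by move=> [i ->] [j ->]; exists (j + i); rewrite -mulgA -expgnDr. Qed.

Lemma same_vertexM R P Q : same_vertex P Q -> same_vertex (R * P) (R * Q).
Proof. by move=> [j ->]; exists j; rewrite mulgA. Qed.

Definition word_mx (w : seq nat) : SL2Z :=
  foldr (fun i P => delta ^+ i * (Delta * P)) 1 w.

Lemma alternating_word i w : reduced (i :: w) -> alternating (word_mx w).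
Proof.
move=> /andP[/= /andP[_ w3] w0]; elim: w w3 w0 {i} => [|i w IH] /=.
  by move=> _ _; exact: alternating1.
move=> /andP[i3 w3] /andP[i0 w0]; rewrite mulgA.
by apply: alternatingM (IH w3 w0); apply: alternating_delta_Delta; lia.
Qed.

Lemma reduced_behead i w : reduced (i :: w) -> reduced w.
Proof.
move=> /andP[/= /andP[_ w3] w0]; rewrite /reduced w3 /=.
by case: w w0 {w3} => //= ? ? /andP[].
Qed.

Lemma word_mx_not_root i w j :
  reduced (i :: w) -> word_mx (i :: w) <> delta ^+ j.
Proof.
move=> red /= e.
apply: (not_alternating (j := (5 * j + i)%N) (alternating_word red)).
suff -> : Delta * word_mx w * delta ^+ (5 * j + i) = 1 by exact: alternating1.
have {}e : Delta * word_mx w = delta ^- i * delta ^+ j by rewrite -e mulKg.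
rewrite e -!mulgA -expgnDr addnA -mulSn expgnDr expgnA delta6 expg1n mul1g.
exact: mulVg.
Qed.

(** Ping-pong: equal first letters cancel, while distinct ones would make Delta times an alternating
    matrix, up to a power of delta, alternating again. *)
Lemma word_mx_uniq u v :
  reduced u -> reduced v -> same_vertex (word_mx u) (word_mx v) -> u = v.
Proof.
elim: u v => [|i u IH] [|j v] ru rv //.
- move=> /same_vertex_sym [k].
  by rewrite [word_mx [::]]/= mul1g => /(word_mx_not_root rv).
- by move=> [k]; rewrite [word_mx [::]]/= mul1g => /(word_mx_not_root ru).
move=> [k /= e]; have [ij|ij] := eqVneq i j.
  rewrite ij in e *; congr (_ :: _).
  apply: IH (reduced_behead ru) (reduced_behead rv) _.
  exists k; apply: (mulgI Delta); apply: (mulgI (delta ^+ j)).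
  by rewrite e !mulgA.
exfalso; apply: (not_alternating (j := k) (alternating_word rv)).
have -> : Delta * word_mx v * delta ^+ k =
    (delta ^+ (6 - j + i) * Delta) * word_mx u.
  rewrite expgnDr -!mulgA e !mulgA -expgnDr subnK ?delta6 ?mul1g //.
  by case/andP: rv => /= /andP[] /ltnW; lia.
apply: alternatingM (alternating_word ru); apply: alternating_delta_Delta.
by case/andP: rv => /= /andP[? _] _; case/andP: ru => /= /andP[? _] _; lia.
Qed.

Lemma word_mx_tact w :
  reduced w -> same_vertex (delta * word_mx w) (word_mx (tact w)).
Proof.
case: w => [|i w]; first by exists 1%N; rewrite /= mulg1 mul1g.
move=> /andP[/= /andP[i3 _] _]; rewrite mulgA -expgS.
have [i2|i2] := eqVneq i 2; last first.
  by rewrite modn_small; [exact: same_vertex_refl|lia].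
by exists 3; rewrite i2 modnn mul1g; apply/esym/delta3_central.
Qed.

Lemma word_mx_sact w : same_vertex (Delta * word_mx w) (word_mx (sact w)).
Proof.
case: w => [|[|i] w]; try by rewrite /= mul1g; exact: same_vertex_refl.
by exists 3; rewrite /= mul1g mulgA Delta_sq; apply/esym/delta3_central.
Qed.

Lemma word_exists P : exists2 w, reduced w & same_vertex P (word_mx w).
Proof.
elim/SL2Z_generated: P => [|P [w rw Pw]|P [w rw Pw]].
- by exists [::] => //; exact: same_vertex_refl.
- exists (tact w); first exact: tact_reduced.
  exact: same_vertex_trans (same_vertexM _ Pw) (word_mx_tact rw).
- exists (sact w); first exact: sact_reduced.
  exact: same_vertex_trans (same_vertexM _ Pw) (word_mx_sact w).
Qed.

(** Bounding the exponent by the order of delta makes the predicate boolean, as [xchoose]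
    requires. *)
Definition is_code (P : SL2Z) (w : seq nat) : bool :=
  reduced w && [exists j : 'I_6, P == word_mx w * delta ^+ j].

Lemma is_codeP P w :
  reflect (reduced w /\ same_vertex P (word_mx w)) (is_code P w).
Proof.
apply: (iffP andP) => [[-> /existsP[j /eqP e]]|[-> [j e]]]; split => //.
  by exists j.
apply/existsP; have j6 : j %% 6 < 6 by rewrite ltn_pmod.
by exists (Ordinal j6); rewrite e delta_modn.
Qed.

Lemma code_exists P : exists w, is_code P w.
Proof. by have [w rw Pw] := word_exists P; exists w; apply/is_codeP. Qed.

Definition code (P : SL2Z) : seq nat := xchoose (code_exists P).

Lemma code_reduced P : reduced (code P).
Proof. by have /is_codeP[] := xchooseP (code_exists P). Qed.

Lemma codeK P : same_vertex P (word_mx (code P)).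
Proof. by have /is_codeP[] := xchooseP (code_exists P). Qed.

Lemma code_uniq P w : reduced w -> same_vertex P (word_mx w) -> code P = w.
Proof.
move=> rw Pw; apply: word_mx_uniq => //; first exact: code_reduced.
by apply: same_vertex_trans Pw; apply/same_vertex_sym/codeK.
Qed.

Lemma code_eq P Q : code P = code Q <-> same_vertex P Q.
Proof.
split=> [e|PQ].
  apply: same_vertex_trans (codeK P) _; rewrite e.
  exact/same_vertex_sym/codeK.
apply: code_uniq; first exact: code_reduced.
exact: same_vertex_trans PQ (codeK Q).
Qed.

Lemma code_delta P : code (delta * P) = tact (code P).
Proof.
apply: code_uniq; first exact/tact_reduced/code_reduced.
apply: same_vertex_trans (same_vertexM _ (codeK P)) _.
exact/word_mx_tact/code_reduced.
Qed.

Lemma code_Delta P : code (Delta * P) = sact (code P).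
Proof.
apply: code_uniq; first exact/sact_reduced/code_reduced.
exact: same_vertex_trans (same_vertexM _ (codeK P)) (word_mx_sact (code P)).
Qed.

Lemma code1 : code 1 = [::].
Proof. by apply: code_uniq => //; exact: same_vertex_refl. Qed.

(** * The tree metric on cosets and its invariance *)

Definition dist (P Q : SL2Z) : nat := wdist (code P) (code Q).

Lemma distM R P Q : dist (R * P) (R * Q) = dist P Q.
Proof.
elim/SL2Z_generated: R P Q => [P Q|R IH P Q|R IH P Q];
  rewrite -?mulgA ?mul1g //.
  by rewrite /dist !code_delta wdist_tact ?code_reduced //; apply: IH.
by rewrite /dist !code_Delta wdist_sact ?code_reduced //; apply: IH.
Qed.

Lemma dist_sym P Q : dist P Q = dist Q P.
Proof. by rewrite /dist /wdist lcp_sym addnC. Qed.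

Lemma dist_four_point p x y z :
  dist p x + dist y z <= maxn (dist p y + dist x z) (dist p z + dist x y).
Proof. exact: wdist_four_point. Qed.

(** A tree is bipartite, so closed paths have even length. *)
Lemma dist_parity x y z : odd (dist x y + dist y z + dist x z) = false.
Proof.
rewrite /dist; have := wdist_lcp (code x) (code y).
have := wdist_lcp (code y) (code z); have := wdist_lcp (code x) (code z); lia.
Qed.

Lemma dist_eq0 P Q : dist P Q = 0 <-> same_vertex P Q.
Proof.
split=> [/wdist_eq0 e|/code_eq e]; first exact/code_eq.
by rewrite /dist e wdistxx.
Qed.

Lemma dist1 P : dist 1 P = size (code P).
Proof. by rewrite /dist code1 /wdist add0n subn0. Qed.

Lemma dist_triangle x y z : dist x z <= dist x y + dist y z.
Proof.
by have := dist_four_point x z y y; have /dist_eq0 -> := same_vertex_refl y;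
  rewrite (dist_sym z y); lia.
Qed.

(** * Conjugates of U as translations along axes *)

Lemma code_delta3 P : code (delta ^+ 3 * P) = code P.
Proof. by apply/code_eq; exists 3; apply/esym/delta3_central. Qed.

Lemma code_U P : code (U * P) = sact (tact (tact (code P))).
Proof.
have -> : U = Delta * (delta * (delta * delta ^+ 3)).
  by rewrite DeltaE -mulgA -!expgS delta6 mulg1.
by rewrite -(mulgA Delta) code_Delta -2!(mulgA delta) 2!code_delta code_delta3.
Qed.

Lemma code_UV P : code (U^-1 * P) = tact (sact (code P)).
Proof.
by rewrite U_inv -(mulgA delta) code_delta -mulgA code_Delta code_delta3.
Qed.

(* [b] is the projection of [P] to the axis of [U]. *)
Lemma U_axis P : exists2 b, dist b (U * b) = 1%N &
  dist P (U * P) = (2 * dist P b + 1)%N.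
Proof.
have [n] := ubnP (size (code P)); elim: n => // n IH in P *; rewrite ltnS => Pn.
(* The axis of U meets the root and runs into the branches 0 and 1, so the root and the vertices of
   branch 2 project to the root. The default 2 of [head] covers the root; in the other branches U^-1
   or U shortens the code. *)
have base : head 2 (code P) = 2 -> exists2 b, dist b (U * b) = 1%N &
    dist P (U * P) = (2 * dist P b + 1)%N.
  move=> h2; exists 1; first by rewrite dist1 code_U code1.
  rewrite (dist_sym P 1) dist1 /dist code_U.
  by case: (code P) h2 => //= _ w ->; rewrite /wdist /=; lia.
have := code_reduced P.
case e: (code P) base Pn => [|[|[|[|i]]] w] //= base Pn _.
- exact: base.
- have [|b b1 Pb] := IH (U^-1 * P).
    by rewrite code_UV e; case: w {e base} Pn => //=; lia.
  exists (U * b); first by rewrite distM.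
  by rewrite -{1 3}(mulVKg U P) !distM -Pb mulVKg.
- have [|b b1 Pb] := IH (U * P).
    by rewrite code_U e.
  exists (U^-1 * b); first by rewrite mulVKg -{2}(mulKg U b) distM.
  by rewrite -(distM U) Pb -(distM U P) mulVKg.
- exact: base.
Qed.

Lemma conj_axis T P : is_conjugate U T -> exists2 b, dist b (T * b) = 1%N &
  dist P (T * P) = (2 * dist P b + 1)%N.
Proof.
move=> [z ->]; have [b b1 Pb] := U_axis (z * P).
exists (z^-1 * b).
  by rewrite -(distM z) -b1 /conjg -!mulgA !mulVKg.
by rewrite -(distM z) -[in RHS](distM z) /conjg -!mulgA !mulVKg.
Qed.

Lemma conj_dist_neq T P : is_conjugate U T -> dist 1 (T * P) <> dist 1 P.
Proof.
move=> TU e; have [b _ Pb] := conj_axis P TU.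
by have := dist_parity 1 P (T * P); rewrite e Pb; lia.
Qed.

Lemma conj_U_entries T : is_conjugate U T -> exists a c : int,
  SL2Z_mx T = mx2 (1 - a * c) (a * a) (- (c * c)) (1 + a * c).
Proof.
move=> [z ->]; case: (SL2Z_entries z) => a [b [c [d [hz det1]]]].
exists d, (- c)%R.
have -> : U ^ z = z^-1 * (U * z) by [].
suff e : (z * (U ^ z)) = U * z.
  have : exists w, SL2Z_mx w = mx2 d (- b) (- c) a /\ w * z = 1.
    have dw : (\det (mx2 d (- b) (- c) a) == 1)%R.
      by rewrite det_mx2; apply/eqP; rewrite -det1; ring.
    exists (MkSL2Z dw); split=> //; apply: SL2Z_mx_inj.
    rewrite SL2Z_mxM hz mx_1 mx2M.
    by congr mx2; lia.
  move=> [w [hw wz]].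
  have -> : z^-1 = w by rewrite -(mulgK z w) wz mul1g.
  rewrite SL2Z_mxM (SL2Z_mxM U) hw mx_U hz !mx2M.
  by congr mx2; lia.
by rewrite conjgE mulVKg.
Qed.

(** Trace 2 leaves only the residues 0 and 5 of [k] modulo 6; for 5 the product is V^-1, with lower
    left entry 1, which is not minus a square. *)
Lemma conj_U_delta k : is_conjugate U (U * delta ^+ k) -> delta ^+ k = 1.
Proof.
rewrite delta_modn => /conj_U_entries [a [c]].
have : k %% 6 < 6 by rewrite ltn_pmod.
case: (k %% 6) => [|[|[|[|[|[|//]]]]]] // _;
  rewrite SL2Z_mxM mx_U ?mx_delta ?mx_delta2 ?mx_delta3 ?mx_delta4 ?mx_delta5
    mx2M;
  by move=> /mx2_inj [] *; nia.
Qed.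

(* The lower left entry of a conjugate of U is nonpositive, which excludes the
   other candidate, V^-1. *)
Lemma short_conj T : is_conjugate U T -> dist 1 T = 1%N ->
  exists i, T = U ^ (delta ^- i).
Proof.
move=> TU; rewrite dist1; have := codeK T; case: (code T) => [|i [|]] //.
rewrite /= mulg1 => -[j e] _; exists i.
have -> : T = delta ^+ i * (U * delta ^+ (j + i).+1) * delta ^- i.
  by rewrite expgS expgnDr e DeltaE !mulgA mulgK.
suff -> : delta ^+ (j + i).+1 = 1 by rewrite mulg1 conjgE invgK mulgA.
apply: conj_U_delta; case: TU => z hz; exists (z * delta ^+ i).
rewrite conjgM -hz conjgE e DeltaE expgS expgnDr !mulgA mulVg mul1g.
by rewrite -!mulgA.
Qed.

(* [y], [x], [z] are consecutive points of a path with a peak at [x] above the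
   root [o]; [z] and [x'] are the images of [x] and [y] under a translation
   taking the projection [b] of [x] to its axis to [b']. The geodesics from [x]
   to [y] and to [z] share their first [d + 1] edges, so [y] is close to [b]. *)
Lemma peak_fold o x y z b b' x' (d e : nat) :
  dist x y = (2 * d + 1)%N -> dist x z = (2 * e + 1)%N -> d < e ->
  dist o y < dist o x -> dist o z < dist o x ->
  dist x b = e -> dist b z <= e + 1 ->
  dist b b' <= 1%N -> dist b' x' = dist b y -> dist x' z = dist x y ->
  dist o x' < dist o x.
Proof.
move=> xy xz de yx zx xb bz bb b'x' x'z.
have yz : dist y z <= 2 * e by have := dist_four_point o x y z; lia.
have by_ : dist b y <= e - 1.
  have := dist_four_point x z y b.
  by rewrite (dist_sym y b) (dist_sym z b) (dist_sym z y); lia.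
have xx' : dist x x' <= 2 * e.
  by have := dist_triangle x b x'; have := dist_triangle b b' x'; lia.
by have := dist_four_point o x' x z; rewrite (dist_sym x' x); lia.
Qed.

(* In the balanced case the two translations move the same edge, in opposite
   directions. *)
Lemma peak_edge o x y z p q b c (d : nat) :
  dist x y = (2 * d + 1)%N -> dist x z = (2 * d + 1)%N ->
  dist o y < dist o x -> dist o z < dist o x ->
  dist x p = d -> dist p q = 1%N -> dist q y = d ->
  dist x b = d -> dist b c = 1%N -> dist c z = d ->
  dist p b = 0 /\ dist q c = 0.
Proof.
move=> xy xz yx zx xp pq qy xb bc cz.
have yz : dist y z <= 2 * d by have := dist_four_point o x y z; lia.
have py : dist p y <= d + 1 by have := dist_triangle p q y; lia.
have bz : dist b z <= d + 1 by have := dist_triangle b c z; lia.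
have xq : dist x q <= d + 1 by have := dist_triangle x p q; lia.
have xc : dist x c <= d + 1 by have := dist_triangle x b c; lia.
have pz : dist p z <= d + 1.
  by have := dist_four_point x y p z; rewrite (dist_sym y p); lia.
have qz : dist q z <= d.
  by have := dist_four_point x y q z; rewrite (dist_sym y q); lia.
split.
  by have := dist_four_point x z p b;
    rewrite (dist_sym z b) (dist_sym z p); lia.
by have := dist_four_point x z q c; rewrite (dist_sym z c) (dist_sym z q); lia.
Qed.

(* The two translations of the balanced case turn to different sides at the
   common edge, so the path has to go through that edge itself. *)
Lemma U_V_fork P : dist P (U * P) = (2 * dist P 1%g + 1)%N ->
  dist (U * P) (delta * P) = (2 * dist P 1%g + 1)%N -> dist 1 P = 0.
Proof.
rewrite (dist_sym P 1) dist1 /dist code_U code_delta.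
have := code_reduced P; case: (code P) => [|[|[|[|i]]] w] //= red.
- by rewrite /wdist /=; lia.
- by rewrite /wdist /=; lia.
- by rewrite /wdist /=; lia.
Qed.

(** * Short conjugates of U, and Hurwitz moves on a pair *)

Lemma V_conj : V = U ^ delta.
Proof. by rewrite conjgE -delta_V mulKg. Qed.

Lemma dist_congr P Q R : same_vertex P Q -> dist R P = dist R Q.
Proof. by move=> /code_eq e; rewrite /dist e. Qed.

Lemma delta3X_conj n P : P ^ (delta ^+ (3 * n)) = P.
Proof.
rewrite expgnA; elim: n => [|n IH]; first by rewrite conjg1.
rewrite expgS conjgM; have -> // : P ^ (delta ^+ 3) = P.
by rewrite conjgE delta3_central mulKg.
Qed.

Lemma code_delta_U n : code (delta ^+ n * U) = [:: n %% 3].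
Proof.
elim: n => [|n IH]; first by rewrite mul1g -[U]mulg1 code_U code1.
by rewrite expgS -mulgA code_delta IH /= -addn1 modnDml addn1.
Qed.

Lemma deltaVX n : delta ^- n = delta ^+ (5 * n).
Proof. by rewrite expgnA -deltaV expVgn. Qed.

Lemma dist_deltar P Q n : dist P (Q * delta ^+ n) = dist P Q.
Proof. by apply: dist_congr; exists n. Qed.

Lemma dist1_deltal P n : dist 1 (delta ^+ n * P) = dist 1 P.
Proof.
rewrite -(distM (delta ^- n)) mulg1 mulKg dist_sym [RHS]dist_sym.
by rewrite -[delta ^- n]mul1g deltaVX dist_deltar.
Qed.

Lemma short_pair g h : is_conjugate U g -> is_conjugate U h ->
  dist 1 h = 1%N -> dist 1 (g * h) = 0 ->
  exists i, g = V ^ (delta ^- i) /\ h = U ^ (delta ^- i).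
Proof.
move=> gU hU h1 gh0; have := gh0; rewrite dist_eq0 => /same_vertex_sym [k].
rewrite mul1g => gh.
have g1 : dist 1 g = 1%N.
  have -> : g = delta ^+ k * h^-1 by rewrite -gh mulgK.
  by rewrite dist1_deltal -(distM h) mulg1 mulgV dist_sym.
have [i hi] := short_conj hU h1; have [j gj] := short_conj gU g1.
exists i; split=> //.
(* [U * delta ^+ m * U] fixes the root vertex only if [m] is 1 modulo 3; here [m] stands for
   [i - j]. *)
have n3 : (5 * j + i) %% 3 = 1%N.
  move: gh0; rewrite gj hi !conjgE !invgK.
  have -> : delta ^+ j * (U * delta ^- j) * (delta ^+ i * (U * delta ^- i)) =
      delta ^+ j * ((U * (delta ^+ (5 * j + i) * U)) * delta ^+ (5 * i)).
    by rewrite expgnDr -!deltaVX !mulgA.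
  rewrite dist1_deltal dist_deltar dist1 code_U code_delta_U /=.
  have := ltn_pmod (5 * j + i) (isT : 0 < 3).
  by case: (_ %% 3) => [|[|[]]].
rewrite gj V_conj; have -> : delta ^- j = delta ^+ (5 * j + i) * delta ^- i.
  by rewrite expgnDr -deltaVX mulgK.
have -> : 5 * j + i = 3 * ((5 * j + i) %/ 3) + 1.
  by rewrite {1}(divn_eq (5 * j + i) 3) n3 mulnC.
by rewrite expgnDr -mulgA conjgM delta3X_conj conjgM.
Qed.

Lemma is_conjugateJ (gT : groupType) (x y z : gT) :
  is_conjugate x y -> is_conjugate x (y ^ z).
Proof. by move=> [w ->]; exists (w * z); rewrite conjgM. Qed.

Lemma is_conjugate_U_V : is_conjugate U V.
Proof. by exists delta; exact: V_conj. Qed.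

(** By the braid relation, V U V^-1 is the conjugate of V by delta, and V is that of U. So one right
    move conjugates both members of the pair (V, U) by delta. *)
Lemma braid_pair_rot z n :
  hurwitz_moves [:: V ^ z; U ^ z]
    [:: V ^ (delta ^+ n * z); U ^ (delta ^+ n * z)].
Proof.
elim: n => [|n IH]; first by rewrite mul1g; exact: rt_refl.
apply: rt_trans IH _; rewrite expgS -mulgA; move: (_ * z) => {}z.
rewrite [U ^ (delta * z)]conjgM -V_conj.
have -> : V ^ (delta * z) = V ^ z * U ^ z * (V ^ z)^-1.
  rewrite conjgM -conjVg -!conjMg; congr (_ ^ z).
  rewrite -delta.unlock; apply: (mulgI delta); apply: (mulIg V).
  by rewrite conjgE mulVKg mulgA mulgVK -mulgA delta_V mulgA -delta.unlock.
exact: rt_step (hurwitz_move_right [::] [::] (V ^ z) (U ^ z)).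
Qed.

Lemma peak_reduction g h P : is_conjugate U g -> is_conjugate U h ->
  dist 1 P < dist 1 (h * P) -> dist 1 (g * (h * P)) < dist 1 (h * P) ->
  (exists g' h', [/\ is_conjugate U g', is_conjugate U h', g' * h' = g * h,
     hurwitz_moves [:: g; h] [:: g'; h'] & dist 1 (h' * P) < dist 1 (h * P)])
  \/ (dist 1 P = 0 /\ hurwitz_moves [:: g; h] [:: V; U]).
Proof.
move=> gU hU yx zx.
have [q q1 xy] := conj_axis P hU; have [b b1 xz] := conj_axis (h * P) gU.
have bz : dist b (g * (h * P)) <= dist (h * P) b + 1.
  have := dist_triangle b (g * b) (g * (h * P)).
  by rewrite distM (dist_sym _ b) b1; lia.
have py : dist (h * q) P <= dist P q + 1.
  have := dist_triangle (h * q) q P.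
  by rewrite (dist_sym (h * q) q) q1 (dist_sym q P); lia.
have [de|ed|de] := ltngtP (dist P q) (dist (h * P) b).
- left; exists (g * h * g^-1), g; split=> //; last 1 first.
  + apply: (@peak_fold 1 (h * P) P (g * (h * P)) b (g * b) (g * P) _ _ _ _ de);
      rewrite ?distM ?b1 //; by rewrite dist_sym.
  + by have := is_conjugateJ g^-1 hU; rewrite conjgE invgK mulgA.
  + by rewrite mulgVK.
  + exact: rt_step (hurwitz_move_right [::] [::] g h).
- left; exists h, (h^-1 * g * h); split=> //; last 1 first.
  + have hx : h * (h^-1 * g * h * P) = g * (h * P).
      by rewrite !mulgA mulgV mul1g.
    apply: (@peak_fold 1 (h * P) (g * (h * P)) P (h * q) q _ _ _ _ _ ed);
      rewrite ?distM //; try by rewrite dist_sym.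
    * by rewrite dist_sym q1.
    * by rewrite -[LHS](distM h) hx.
    * by rewrite -[LHS](distM h) hx dist_sym.
  + by have := is_conjugateJ h gU; rewrite conjgE mulgA.
  + by rewrite !mulgA mulgV mul1g.
  + exact: rt_step (hurwitz_move_left [::] [::] g h).
have [] := @peak_edge 1 (h * P) P (g * (h * P)) (h * q) q b (g * b) (dist P q);
  rewrite ?distM //; try by rewrite dist_sym.
  by rewrite de.
move=> pb qc.
have gh_q : dist 1 (g ^ q * h ^ q) = 0.
  rewrite -conjMg -(distM q) mulg1 conjgE mulVKg -mulgA.
  apply/eqP; rewrite -leqn0; apply: leq_trans (dist_triangle q (g * b) _) _.
  by rewrite distM (dist_sym b) pb qc.
have h_q : dist 1 (h ^ q) = 1%N by rewrite -(distM q) mulg1 conjgE mulVKg.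
have [i [gi hi]] :=
  short_pair (is_conjugateJ q gU) (is_conjugateJ q hU) h_q gh_q.
(* Both factors move the edge from [q] to [h * q], in opposite directions; [w] carries [q] to the
   root and the pair to (V, U). *)
have [w [gw hw wq]] :
    exists w, [/\ g = V ^ w, h = U ^ w & forall R, dist R (w * q) = dist R 1].
  exists (delta ^- i * q^-1); rewrite !conjgM -gi -hi !conjgK; split=> // R.
  by rewrite mulgVK deltaVX -[_ ^+ _]mul1g dist_deltar.
have wJ X R : w * (X ^ w * R) = X * (w * R).
  by rewrite conjgE !mulgA mulgV mul1g.
have wh R : w * (h * R) = U * (w * R) by rewrite hw wJ.
have wg R : w * (g * R) = V * (w * R) by rewrite gw wJ.
have dE : dist (w * P) 1 = dist P q by rewrite -wq distM.
have P0 : dist 1 (w * P) = 0.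
  apply: U_V_fork; first by rewrite -wh distM dE.
  by rewrite delta.unlock -(mulgA V) -wh -wg distM dE xz de.
have Pq R : dist R P = dist R q.
  apply/dist_congr/dist_eq0; rewrite -dE dist_sym //.
have Pw : dist 1 P = size (code w).
  by rewrite Pq -dist1 [RHS]dist_sym -wq -{1}(mulg1 w) distM.
case e : (code w) Pw => [|j u] /= Pw; [right; split=> //|left].
  have : dist 1 w = 0 by rewrite dist1 e.
  rewrite dist_eq0 => /same_vertex_sym [m]; rewrite mul1g => wm.
  rewrite gw hw wm; have := braid_pair_rot (delta ^+ m) (5 * m).
  by rewrite -expgnDr addnC -mulSn expgnA delta6 expg1n !conjg1.
(* After translation by [w], [P] sits at the root and the old root at [w]. Rotating by [- j] sends
   [h' * P] to the child [[:: j]], the first vertex on the way to [w]. *)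
exists (V ^ (delta ^+ (5 * j) * w)), (U ^ (delta ^+ (5 * j) * w)); split.
- exact/is_conjugateJ/is_conjugate_U_V.
- by exists (delta ^+ (5 * j) * w).
- rewrite gw hw -!conjMg conjgM; congr (_ ^ w).
  by rewrite -delta.unlock conjgE -expgS expgSr mulKg.
- by rewrite gw hw; exact: braid_pair_rot.
apply: leq_ltn_trans yx; rewrite Pw.
have [k wP] : same_vertex (w * P) 1 by apply/dist_eq0; rewrite dist_sym.
have j3 : j < 3 by have := code_reduced w; rewrite e => /andP[/= /andP[]].
have PE : w * (U ^ (delta ^+ (5 * j) * w) * P) =
    delta ^+ j * U * delta ^+ (5 * j + k).
  rewrite conjgM wJ wP mul1g -deltaVX conjgE invgK deltaVX.
  by rewrite (expgnDr _ (5 * j)) !mulgA.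
rewrite -(distM w) mulg1 PE dist_deltar /dist e code_delta_U modn_small //.
by rewrite /wdist /= eqxx; lia.
Qed.

(** * Hurwitz moves on tuples and the ascending normal form *)

Section Hurwitz.
Variable gT : groupType.
Implicit Types (g h : gT) (s t u : seq gT).

Lemma product_cons g s : product (g :: s) = g * product s.
Proof. by rewrite /product big_cons. Qed.

Lemma product_cat s t : product (s ++ t) = product s * product t.
Proof. by rewrite /product big_cat. Qed.

Lemma hurwitz_move_cat s t u v :
  hurwitz_move s t -> hurwitz_move (u ++ s ++ v) (u ++ t ++ v).
Proof.
case=> {}s {}t g h; rewrite -!catA !(catA u); first exact: hurwitz_move_left.
exact: hurwitz_move_right.
Qed.

Lemma hurwitz_moves_cat s t u v :
  hurwitz_moves s t -> hurwitz_moves (u ++ s ++ v) (u ++ t ++ v).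
Proof.
elim=> [{}s {}t st|{}s|{}s r {}t _ + _]; first exact/rt_step/hurwitz_move_cat.
  exact: rt_refl.
exact: rt_trans.
Qed.

Lemma hurwitz_moves_cons g s t :
  hurwitz_moves s t -> hurwitz_moves (g :: s) (g :: t).
Proof. by move=> /(hurwitz_moves_cat [:: g] [::]); rewrite !cats0. Qed.

Lemma hurwitz_moves_catr s t u :
  hurwitz_moves s t -> hurwitz_moves (s ++ u) (t ++ u).
Proof. exact: hurwitz_moves_cat [::] u. Qed.

Lemma hurwitz_move_product s t : hurwitz_move s t -> product s = product t.
Proof.
by case=> {}s {}t g h; rewrite !product_cat !product_cons; congr (_ * _);
  rewrite !mulgA ?mulgV ?mul1g ?mulgVK.
Qed.

Lemma hurwitz_moves_product s t : hurwitz_moves s t -> product s = product t.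
Proof.
by elim=> [{}s {}t /hurwitz_move_product| |{}s r {}t _ -> _ ->].
Qed.

Lemma hurwitz_moves_size s t : hurwitz_moves s t -> size s = size t.
Proof.
by elim=> [{}s {}t []* | |{}s r {}t _ -> _ ->]; rewrite ?size_cat.
Qed.

End Hurwitz.

Definition conj_seq (G : seq SL2Z) : Prop :=
  forall g, g \in G -> is_conjugate U g.

Lemma conj_seq_cons g s :
  conj_seq (g :: s) <-> is_conjugate U g /\ conj_seq s.
Proof.
split=> [gs|[gU sU] h]; last by rewrite in_cons => /predU1P[->|/sU].
by split=> [|h hs]; apply: gs; rewrite in_cons ?eqxx ?hs ?orbT.
Qed.

Lemma conj_seq_cat s t : conj_seq s -> conj_seq t -> conj_seq (s ++ t).
Proof. by move=> sU tU g; rewrite mem_cat => /orP[/sU|/tU]. Qed.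

Lemma conj_seq_VU_pow k : conj_seq (VU_pow k).
Proof.
elim: k => // k IH; apply/conj_seq_cons; split; first exact: is_conjugate_U_V.
by apply/conj_seq_cons; split=> //; exists 1; rewrite conjg1.
Qed.

Lemma product_VU_pow k : product (VU_pow k) = delta ^+ k.
Proof.
elim: k => [|k IH]; first by rewrite /product big_nil.
by rewrite [VU_pow _]/= !product_cons IH mulgA -delta.unlock -expgS.
Qed.

(** The termination measure: folding a peak changes a single suffix product and lowers its
    summand. *)
Fixpoint suffix_height (G : seq SL2Z) : nat :=
  if G is _ :: s then dist 1 (product G) + suffix_height s else 0.

Fixpoint ascending (A : seq SL2Z) (Q : SL2Z) : Prop :=
  if A is g :: s then
    dist 1 (product s * Q) < dist 1 (g * (product s * Q)) /\ ascending s Q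
  else True.

(** Induction on the length and, inside it, on the height. The last clause ensures that normalizing
    the tail first does not raise the height before a peak is folded. *)
Lemma ascending_normal_form G : conj_seq G -> exists A k,
  [/\ hurwitz_moves G (A ++ VU_pow k), conj_seq A, ascending A (delta ^+ k)
    & suffix_height (A ++ VU_pow k) <= suffix_height G].
Proof.
have [n] := ubnP (size G); elim: n => // n IHn in G *.
have [m] := ubnP (suffix_height G); elim: m => // m IHm in G *.
rewrite !ltnS; case: G => [|g s] Gm Gn.
  by move=> _; exists [::], 0; split=> //; exact: rt_refl.
move=> /conj_seq_cons[gU sU].
have [A [k [sA AU Aasc Am]]] := IHn s Gn sU.
have GA : hurwitz_moves (g :: s) (g :: A ++ VU_pow k).
  exact: hurwitz_moves_cons.
have gAm : suffix_height (g :: A ++ VU_pow k) <= suffix_height (g :: s).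
  by rewrite /= !product_cons (hurwitz_moves_product sA) leq_add2l.
have := @conj_dist_neq g (product A * delta ^+ k) gU.
have [up _|dn _|/esym e /(_ e)//] :=
  ltngtP (dist 1 (product A * delta ^+ k))
    (dist 1 (g * (product A * delta ^+ k))).
  by exists (g :: A), k; split=> //; apply/conj_seq_cons.
case: A sA AU Aasc Am GA gAm dn => [|h A] sA AU Aasc Am GA gAm dn.
  move: dn; rewrite [X in _ < X -> _]dist_deltar.
  by rewrite /product big_nil (dist1 1) code1.
have [hU AU'] := (conj_seq_cons h A).1 AU; case: Aasc => hup Aasc.
rewrite product_cons -mulgA in dn.
have [[g' [h' [gU' hU' gh' ghH lt]]]|[Q0 ghH]] := peak_reduction gU hU hup dn.
- have GH : hurwitz_moves (g :: s) [:: g', h' & A ++ VU_pow k].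
    apply: rt_trans GA _; exact: (hurwitz_moves_catr (A ++ VU_pow k) ghH).
  have [|||B [l [HB BU Basc Bm]]] := IHm [:: g', h' & A ++ VU_pow k].
  + apply: leq_trans Gm; apply: leq_trans gAm.
    rewrite /= !product_cons !product_cat product_VU_pow !mulgA gh' -!mulgA.
    by rewrite ltn_add2l ltn_add2r.
  + by rewrite -(hurwitz_moves_size GH).
  + do 2!(apply/conj_seq_cons; split=> //).
    by apply: conj_seq_cat => //; exact: conj_seq_VU_pow.
  exists B, l; split=> //; first exact: rt_trans GH HB.
  apply: leq_trans Bm _; apply: leq_trans gAm.
  rewrite /= !product_cons !product_cat product_VU_pow !mulgA gh' -!mulgA.
  by rewrite leq_add2l leq_add2r ltnW.
(* An ascending path is never back at the root, so the peak starts from the end of the VU block, and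
   the new pair (V, U) extends that block. *)
have A0 : A = [::].
  case: A Aasc Q0 {sA AU Am GA gAm dn hup AU'} => //= a A [up _].
  by rewrite product_cons -mulgA => Q0; rewrite Q0 in up.
subst A; exists [::], k.+1; split=> //.
  by apply: rt_trans GA _; apply: (hurwitz_moves_catr (VU_pow k) ghH).
apply: leq_trans gAm.
rewrite /= !product_cons product_VU_pow addnA addnA leq_add2r.
rewrite mulgA -delta.unlock -expgS -[delta ^+ k.+1]mul1g !dist_deltar.
rewrite !dist1 code1 -[U]mulg1 code_U code1 /=; apply: leq_trans (leq_addl _ _).
move: hup; rewrite /product big_nil mul1g dist_deltar (dist1 h).
exact: leq_ltn_trans.
Qed.

(** * Rigidity of ascending paths that end at a power of U *)

Lemma code_UX n : code (U ^+ n) = if n is m.+1 then 0 :: nseq m 2 else [::].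
Proof.
elim: n => [|n IH]; first exact: code1.
by rewrite expgS code_U IH; case: n {IH}.
Qed.

Lemma dist_UX m n : dist (U ^+ m) (U ^+ (m + n)) = n.
Proof.
rewrite expgnDr -{1}(mulg1 (U ^+ m)) distM dist1 code_UX.
by case: n => //= n; rewrite size_nseq.
Qed.

Lemma dist1_UX n : dist 1 (U ^+ n) = n.
Proof. exact: (dist_UX 0). Qed.

(** Geodesics in a tree are unique, here by the four-point inequality. *)
Lemma geodesic_UX P m n :
  dist 1 P = m -> dist P (U ^+ (m + n)) = n -> dist P (U ^+ m) = 0.
Proof.
move=> Pm Pn; have := dist_four_point 1 (U ^+ (m + n)) P (U ^+ m).
rewrite !dist1_UX Pm (dist_sym _ P) Pn (dist_sym (U ^+ (m + n)) (U ^+ m)).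
rewrite dist_UX maxnn.
by rewrite -[leqRHS]addn0 leq_add2l leqn0 => /eqP.
Qed.

(** The path ends by following the axis of [v] along one edge, and this edge lies on the geodesic
    from the root to [U ^+ n]. Hence [v] agrees with U on its initial vertex, and [conj_U_delta]
    removes the remaining power of delta. *)
Lemma last_step v P n j : is_conjugate U v -> v * P = U ^+ n * delta ^+ j ->
  dist 1 P < dist 1 (v * P) -> v = U /\ 0 < n.
Proof.
move=> vU vP; have [q q1 Pq] := conj_axis P vU.
have vp : dist (v * q) (U ^+ n) = dist P q.
  by rewrite -(dist_deltar _ _ j) -vP distM dist_sym.
move: Pq; rewrite vP !dist_deltar dist1_UX => Px Pn.
have n0 : 0 < n by lia.
have qx : dist q (U ^+ n) <= dist P q + 1.
  by have := dist_triangle q (v * q) (U ^+ n); rewrite q1 vp; lia.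
have q_up : dist 1 q + (2 * dist P q + 1) <= n + dist P q.
  have := dist_four_point 1 q (U ^+ n) P.
  by rewrite dist1_UX (dist_sym (U ^+ n)) Px (dist_sym q P); lia.
have q_dn : n <= dist 1 q + dist q (U ^+ n).
  by have := dist_triangle 1 q (U ^+ n); rewrite dist1_UX.
have p_up : dist 1 (v * q) <= dist 1 q + 1.
  by have := dist_triangle 1 q (v * q); rewrite q1.
have p_dn : n <= dist 1 (v * q) + dist P q.
  by have := dist_triangle 1 (v * q) (U ^+ n); rewrite dist1_UX vp.
(* The bounds give [m + dist P q + 1 = n] and place [v * q] at distance [m + 1] from the root, so
   [q] and [v * q] are consecutive vertices of the geodesic. *)
set m := dist 1 q in q_up q_dn p_up p_dn.
have qU : dist q (U ^+ m) = 0.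
  apply: (@geodesic_UX _ _ (dist P q + 1)) => //.
  suff -> : (m + (dist P q + 1) = n)%N by lia.
  by lia.
have pU : dist (v * q) (U ^+ m.+1) = 0.
  apply: (@geodesic_UX _ _ (dist P q)); first by lia.
  by suff -> : (m.+1 + dist P q = n)%N by []; lia.
move: qU pU; rewrite !dist_eq0 => -[a qa] [b]; rewrite qa => vb.
split=> //; suff : v ^ (U ^+ m) = U.
  move/(canRL (conjgK _)) => ->.
  by rewrite conjgE invgK mulgA -expgSr expgS mulgK.
have e : v ^ (U ^+ m) = U * delta ^+ (b + 5 * a).
  apply: (mulIg (delta ^+ a)); apply: (mulgI (U ^+ m)).
  rewrite conjgE -!mulgA mulVKg vb -expgnDr -addnA -mulSnr expgnDr expgnA.
  by rewrite delta6 expg1n mulg1 expgSr mulgA.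
by rewrite e conj_U_delta ?mulg1 // -e; exact: is_conjugateJ.
Qed.

Lemma ascending_UX A n j k : conj_seq A -> ascending A (delta ^+ k) ->
  product A * delta ^+ k = U ^+ n * delta ^+ j ->
  A = nseq n U /\ delta ^+ k = delta ^+ j.
Proof.
elim: A n => [|v A IH] n.
  rewrite /product big_nil mul1g => _ _ e; have : n = 0.
    rewrite -(dist1_UX n) -(dist_deltar _ _ j) -e -[_ ^+ k]mul1g dist_deltar.
    by rewrite dist1 code1.
  by move=> n0; move: e; rewrite n0 mul1g.
move=> /conj_seq_cons[vU AU] [up Aasc]; rewrite product_cons -mulgA => e.
have [vE] := last_step vU e up; case: n e => // n e _; rewrite vE in e *.
have [|-> ->] // := IH n AU Aasc; apply: (mulgI U).
by rewrite e expgS mulgA.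
Qed.

Lemma delta_order k : delta ^+ k = 1 -> 6 %| k.
Proof.
rewrite delta_modn /dvdn; have : k %% 6 < 6 by rewrite ltn_pmod.
case: (k %% 6) => [|[|[|[|[|[|//]]]]]] // _ /(congr1 SL2Z_mx);
  by rewrite mx_1 ?mx_delta ?mx_delta2 ?mx_delta3 ?mx_delta4 ?mx_delta5
    => /mx2_inj[].
Qed.

Lemma hurwitz_normal_form G n j : j < 6 -> conj_seq G ->
  product G = U ^+ n * delta ^+ j ->
  exists i, hurwitz_moves G (nseq n U ++ VU_pow (j + 6 * i)).
Proof.
move=> j6 /ascending_normal_form [A [k [GA AU Aasc _]]].
rewrite (hurwitz_moves_product GA) product_cat product_VU_pow.
move=> /(ascending_UX AU Aasc) [AE kj]; exists (k %/ 6).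
suff -> : (j + 6 * (k %/ 6) = k)%N by rewrite -AE.
have /delta_order : delta ^+ (k + 5 * j) = 1.
  by rewrite expgnDr kj -expgnDr -mulSn expgnA delta6 expg1n.
lia.
Qed.

(** * From the form U^n delta^j to the matrices of the table *)

Lemma VU_pow_add a b : VU_pow (a + b) = VU_pow a ++ VU_pow b.
Proof. by rewrite /VU_pow nseqD flatten_cat. Qed.

Lemma size_VU_pow k : size (VU_pow k) = (2 * k)%N.
Proof. by elim: k => // k IH; rewrite [VU_pow _]/= /= -/(VU_pow k) IH; lia. Qed.

(** Needed for case [III]: its matrix is U delta, so the general normal form starts with U, V, U. *)
Lemma braid_UVU s : hurwitz_moves [:: U, V, U & s] [:: V, U, V & s].
Proof.
apply: rt_trans (rt_step _ _ _ _ (hurwitz_move_left [::] (U :: s) U V)) _.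
have {5}-> : V = U^-1 * (V^-1 * U * V) * U.
  by rewrite {1}V_conj conjgE delta.unlock invgM !mulgA.
exact: rt_step (hurwitz_move_left [:: V] s (V^-1 * U * V) U).
Qed.

(** The bit [e] records the sign, so that plain and starred matrices are treated at once: -1 is
    delta^3, which adds [3 * e] to the exponent. *)
Lemma hurwitz_unstarred T (e : bool) G : ~~ starred T -> conj_seq G ->
  SL2Z_mx (product G) = ((-1) ^+ e *: fiber_mx T)%R ->
  exists i, hurwitz_moves G (mnf T ++ VU_pow (3 * e + 6 * i)).
Proof.
have nf n j : j + 3 * e < 6 -> conj_seq G ->
    SL2Z_mx (product G) = ((-1) ^+ e *: SL2Z_mx (U ^+ n * delta ^+ j)%g)%R ->
    exists i, hurwitz_moves G (nseq n U ++ VU_pow j ++ VU_pow (3 * e + 6 * i)).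
  move=> j6 GU GM; have [|i] := @hurwitz_normal_form G n (j + 3 * e) j6 GU.
    apply: SL2Z_mx_inj; rewrite GM.
    case: e {GM j6}; last by rewrite scale1r addn0.
    rewrite expgnDr mulgA (SL2Z_mxM (_ * _)) mx_delta3 scaleN1r.
    case: (SL2Z_entries (U ^+ n * delta ^+ j)) => a [b [c [d [-> _]]]].
    by rewrite mx2M mx2_N; congr mx2; ring.
  by rewrite -addnA VU_pow_add; exists i.
case: T => //= [w n _|||] _ GU GM.
- have [|||i] := nf n 0 => //; first by case: e {nf GM}.
    by rewrite mulg1 mx_UX.
  by exists i.
- by apply: (nf 0 1%N) => //; [case: e {nf GM}|rewrite mul1g mx_delta].
- have [|||i Gi] := nf 1%N 1%N => //; first by case: e {nf GM}.
    by rewrite -DeltaE mx_Delta.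
  exists i; apply: rt_trans Gi _; exact: braid_UVU.
- by apply: (nf 0 2) => //; [case: e {nf GM}|rewrite mul1g mx_delta2].
Qed.

Lemma unstarred_opp T : starred T -> exists T',
  [/\ ~~ starred T', fiber_mx T = (- fiber_mx T')%R
    & size (mnf T) = (size (mnf T') + 6)%N].
Proof.
case: T => // [n|||] _.
- by exists (wI n (isT : 0 < 1)); rewrite /= mx2_N oppr0 size_cat size_nseq.
- by exists IV; rewrite /= mx2_N.
- by exists III; rewrite /= mx2_N.
- by exists II; rewrite /= mx2_N.
Qed.

Local Open Scope ring_scope.

Theorem theorem19 (T : fiber_case) (M : SL2Z) (G : seq SL2Z) :
  SL2Z_mx M = fiber_mx T ->
  (forall g : SL2Z, g \in G -> is_conjugate U g) ->
  M = product G ->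
  [/\ (size (mnf T) <= size G)%N,
      ~~ starred T ->
        exists D : seq SL2Z,
          hurwitz_moves G (mnf T ++ D) /\ SL2Z_mx (product D) = 1%:M
    & starred T ->
        exists T' : fiber_case,
          [/\ ~~ starred T', fiber_mx T' = - SL2Z_mx M
            & exists D : seq SL2Z,
                hurwitz_moves G (mnf T' ++ D) /\
                SL2Z_mx (product D) = - 1%:M]].
Proof.
move=> MT GU MG; have [sT|sT] := boolP (starred T).
  have [T' [sT' TT' szT]] := unstarred_opp sT.
  have [|i Gi] := @hurwitz_unstarred T' true G sT' GU.
    by rewrite -MG MT TT' scaleN1r.
  split=> //.
    (* The remaining block [VU_pow (3 + 6 * i)] has at least the six factors by which the two
       factorizations differ. *)
    by rewrite szT (hurwitz_moves_size Gi) size_cat size_VU_pow leq_add2l; lia.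
  move=> _; exists T'; split=> //; first by rewrite MT TT' opprK.
  exists (VU_pow (3 + 6 * i)); split=> //.
  rewrite product_VU_pow expgnDr expgnA delta6 expg1n mulg1 mx_delta3.
  by rewrite mx2_1 mx2_N oppr0.
have [|i Gi] := @hurwitz_unstarred T false G sT GU.
  by rewrite -MG MT scale1r.
split=> //; first by rewrite (hurwitz_moves_size Gi) size_cat leq_addr.
move=> _; exists (VU_pow (6 * i)); split=> //.
by rewrite product_VU_pow expgnA delta6 expg1n.
Qed.
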